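(* Let $\Omega$ be a finite set, let $k,l \geq 2$ be multiplicatively independent integers, and let $f \colon \mathbb{N}_0 \to \Omega$ be a sequence. Suppose that $f$ is asymptotically $k$-automatic and asymptotically $l$-automatic. Then $f$ is asymptotically invariant under a non-zero shift, i.e. there exists $q \in \mathbb{N}$ such that $f(n+q) = f(n)$ for almost all $n \in \mathbb{N}_0$.
   Context: $\mathbb{N} = \{1,2,\dots\}$, $\mathbb{N}_0 = \mathbb{N}\cup\{0\}$. Integers $k,l\geq 2$ are multiplicatively dependent if $\log k/\log l \in \mathbb{Q}$, and multiplicatively independent otherwise. For $A \subset \mathbb{N}_0$, the upper density is $\bar d(A) = \limsup_{N\to\infty} |A\cap\{0,\dots,N-1\}|/N$; a property holds for almost all $n\in\mathbb{N}_0$ if the set of $n$ where it fails has upper density $0$. Two sequences $f,g\colon \mathbb{N}_0\to\Omega$ are asymptotically equal, written $f\simeq g$, if $f(n)=g(n)$ for almost all $n$. The $k$-kernel of $f$ is $\mathcal{N}_k(f) = \{ n \mapsto f(k^\alpha n + r) : \alpha, r \in \mathbb{N}_0,\ r < k^\alpha\}$. The sequence $f$ (with $\Omega$ finite) is asymptotically $k$-automatic if the set of equivalence classes $\mathcal{N}_k(f)/{\simeq}$ is finite. *)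

(* Defs.v *)
From mathcomp Require Import all_boot.
From Stdlib Require Import Reals.
Set Implicit Arguments. Unset Strict Implicit. Unset Printing Implicit Defensive.

Definition count_below (A : pred nat) (N : nat) : nat := count A (iota 0 N).

(* Upper density zero: limsup_N |A ∩ [0,N)|/N = 0, i.e. the ratio tends to 0:
   for every m > 0, eventually m * |A ∩ [0,N)| <= N. *)
Definition density_zero (A : pred nat) : Prop :=
  forall m : nat, 0 < m -> exists N0 : nat, forall N : nat, N0 <= N ->
    m * count_below A N <= N.

Definition asym_eq (Omega : eqType) (f g : nat -> Omega) : Prop :=
  density_zero (fun n => f n != g n).

Definition in_kernel (Omega : Type) (k : nat) (f g : nat -> Omega) : Prop :=
  exists alpha r : nat, r < k ^ alpha /\ g = (fun n => f (k ^ alpha * n + r)).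

(* Asymptotically k-automatic: the k-kernel has finitely many ≃-classes,
   i.e. there is a finite list of sequences such that every kernel element is
   asymptotically equal to one of them. *)
Definition asym_automatic (Omega : finType) (k : nat) (f : nat -> Omega) : Prop :=
  exists reps : seq (nat -> Omega),
    forall g, in_kernel k f g -> exists2 h, List.In h reps & asym_eq g h.

Definition mult_independent (k l : nat) : Prop :=
  ~ exists (p q : BinInt.Z), q <> BinInt.Z0 /\
      (ln (INR k) / ln (INR l))%R = (IZR p / IZR q)%R.

(* Main.v *)
(* Almost every block [A n, A n + A), A = k ^ a, of f is determined by a type
   tau n with values in a finite set that does not depend on a, namely the values
   at n of the finitely many representatives of the k-kernel; likewise for
   B = l ^ b.  Take 0 < A - B small compared with B.  Pigeonhole yields two
   positions x and x + d, with d bounded independently of a and b, at which both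
   the k-types and the l-types repeat.  Then f is locally invariant under both
   shifts d A and d B, so it has the local period d (A - B), which is short
   compared with the block.  As f on a block depends on the type only, every type
   of positive upper density has such a short period.  Periods of overlapping
   blocks agree by a Fine-Wilf argument, whence A! is a global asymptotic period. *)
From Stdlib Require Import Reals Classical Lra.
Require Import Defs.
From mathcomp Require Import all_boot.
From mathcomp Require Import zify.
Set Implicit Arguments. Unset Strict Implicit. Unset Printing Implicit Defensive.

(* The key [R] is taken by MathComp's [ring_scope]. *)
Delimit Scope R_scope with Rstd.

(** * Density zero and properties of almost all integers *)

(** [density_zero] takes boolean predicates, so a general proposition is handled through a boolean
    set containing its failures. *)
Definition almost (P : nat -> Prop) : Prop :=
  exists2 A : pred nat, density_zero A & forall n, ~~ A n -> P n.

Lemma count_below_le_size (S : eqType) (A : pred nat) (N : nat) (g : nat -> S)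
    (s : seq S) :
  (forall x y, x < N -> y < N -> A x -> A y -> g x = g y -> x = y) ->
  (forall x, x < N -> A x -> g x \in s) -> count_below A N <= size s.
Proof.
move=> ginj gs; rewrite /count_below -size_filter -(size_map g).
apply: uniq_leq_size.
  rewrite map_inj_in_uniq ?filter_uniq ?iota_uniq // => x y.
  rewrite !mem_filter !mem_iota /= !add0n => /andP[Ax xN] /andP[Ay yN].
  exact: ginj.
move=> z /mapP[x]; rewrite mem_filter mem_iota /= add0n => /andP[Ax xN] ->.
exact: gs.
Qed.

Lemma count_below_sub (A B : pred nat) (N : nat) :
  (forall n, A n -> B n) -> count_below A N <= count_below B N.
Proof. by move=> sAB; apply: sub_count. Qed.

Lemma count_below_or (A B : pred nat) (N : nat) :
  count_below (fun n => A n || B n) N <= count_below A N + count_below B N.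
Proof. by rewrite /count_below -count_predUI leq_addr. Qed.

Lemma density_zero_sub (A B : pred nat) :
  (forall n, A n -> B n) -> density_zero B -> density_zero A.
Proof.
move=> sAB zB m m0; have [N0 H] := zB m m0; exists N0 => N /H.
by apply: leq_trans; rewrite leq_mul2l count_below_sub ?orbT.
Qed.

Lemma density_zero_or (A B : pred nat) :
  density_zero A -> density_zero B -> density_zero (fun n => A n || B n).
Proof.
move=> zA zB m m0.
have [|NA HA] := zA (2 * m); first by rewrite muln_gt0.
have [|NB HB] := zB (2 * m); first by rewrite muln_gt0.
exists (maxn NA NB) => N; rewrite geq_max => /andP[/HA {}HA /HB {}HB].
have := count_below_or A B N; nia.
Qed.

(** The pair ([g], [w]) embeds the bad x below N into [A] below c N times a set of size [b], so the
    count grows by a bounded factor only. *)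
Lemma density_zero_comp (A : pred nat) (c b : nat) (g w : nat -> nat) :
  (forall x y, g x = g y -> w x = w y -> x = y) ->
  (forall x, g x < c * x.+1) -> (forall x, w x < b) ->
  density_zero A -> density_zero (fun x => A (g x)).
Proof.
move=> ginj gle wlt zA m m0.
have c0 : 0 < c by have := gle 0; lia.
have b0 : 0 < b by have := wlt 0; lia.
have [|N0 H] := zA (b * c * m); first by rewrite !muln_gt0 c0 b0.
exists N0 => N leN.
have : count_below (fun x => A (g x)) N <= count_below A (c * N) * b.
  rewrite {2}/count_below -size_filter -(size_iota 0 b) -(size_allpairs pair).
  apply: (@count_below_le_size _ _ _ (fun x => (g x, w x))).
    by move=> x y _ _ _ _ [/ginj H1 /H1].
  move=> x xN Ax; apply/allpairsP; exists (g x, w x); split=> //=.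
    rewrite mem_filter Ax mem_iota /= add0n (leq_trans (gle x)) //.
    by rewrite leq_mul2l xN orbT.
  by rewrite mem_iota wlt.
have /H H' : N0 <= c * N by nia.
move=> le; rewrite -(leq_pmul2l c0) (leq_trans _ H') //.
apply: (@leq_trans (c * (m * (count_below A (c * N) * b)))).
  by rewrite !leq_mul2l le !orbT.
by apply: eq_leq; lia.
Qed.

Lemma almost_all (P : nat -> Prop) : (forall n, P n) -> almost P.
Proof.
move=> HP; exists pred0 => // m _; exists 0 => N _.
by rewrite /count_below count_pred0 muln0.
Qed.

Lemma almost_and (P Q : nat -> Prop) :
  almost P -> almost Q -> almost (fun n => P n /\ Q n).
Proof.
move=> [A zA HA] [B zB HB]; exists (fun n => A n || B n).
  exact: density_zero_or.
by move=> n; rewrite negb_or => /andP[/HA ? /HB].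
Qed.

Lemma almost_mono (P Q : nat -> Prop) :
  (forall n, P n -> Q n) -> almost P -> almost Q.
Proof. by move=> PQ [A zA HA]; exists A => // n /HA /PQ. Qed.

Lemma almost_comp (P : nat -> Prop) (c b : nat) (g w : nat -> nat) :
  (forall x y, g x = g y -> w x = w y -> x = y) ->
  (forall x, g x < c * x.+1) -> (forall x, w x < b) ->
  almost P -> almost (fun x => P (g x)).
Proof.
move=> ginj gle wlt [A zA HA]; exists (fun x => A (g x)).
  exact: density_zero_comp ginj gle wlt zA.
by move=> n /HA.
Qed.

Lemma almost_shift (P : nat -> Prop) (j : nat) :
  almost P -> almost (fun x => P (x + j)).
Proof.
apply: (@almost_comp _ j.+1 1 _ (fun=> 0)) => // x *; [lia | nia].
Qed.

Lemma almost_divn (P : nat -> Prop) (d : nat) :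
  0 < d -> almost P -> almost (fun x => P (x %/ d)).
Proof.
move=> d0; apply: (@almost_comp _ 1 d _ (fun x => x %% d)) => [x y e1 e2|x|x].
- by rewrite (divn_eq x d) e1 e2 -divn_eq.
- by rewrite mul1n ltnS leq_div.
- by rewrite ltn_mod.
Qed.

Lemma almost_forall_lt (P : nat -> nat -> Prop) (b : nat) :
  (forall j, j < b -> almost (P j)) -> almost (fun n => forall j, j < b -> P j n).
Proof.
elim: b => [|b IH] H; first exact: almost_all.
have := almost_and (IH (fun j jb => H j (ltnW jb))) (H b (ltnSn b)).
apply: almost_mono => n [H1 H2] j; rewrite ltnS leq_eqVlt => /orP[/eqP-> //|].
exact: H1.
Qed.

Lemma almost_forall_seq (I : eqType) (P : I -> nat -> Prop) (s : seq I) :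
  (forall i, i \in s -> almost (P i)) ->
  almost (fun n => forall i, i \in s -> P i n).
Proof.
elim: s => [|a s IH] H; first exact: almost_all.
have Hs i : i \in s -> almost (P i) by move=> si; apply: H; rewrite inE si orbT.
have := almost_and (H a (mem_head _ _)) (IH Hs).
apply: almost_mono => n [H1 H2] i; rewrite inE => /predU1P[-> //|]; exact: H2.
Qed.

(** * Types of blocks *)

(** [T] and [tau] are fixed before the exponent [a]; only the decoder [W] depends on it. Blocks can
    thus grow while the number of types stays fixed. [c] counts consecutive blocks. *)
Definition block_types (Omega : Type) (k c : nat) (f : nat -> Omega)
    (T : finType) (tau : nat -> T) : Prop :=
  forall a, exists W : T -> nat -> Omega,
    almost (fun n => forall r, r < c * k ^ a -> f (k ^ a * n + r) = W (tau n) r).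

Lemma In_nth_lt (S : Type) (x0 h : S) (s : seq S) :
  List.In h s -> exists2 i, i < size s & h = nth x0 s i.
Proof.
elim: s => //= a s IH [<-|/IH[i ilt ->]]; first by exists 0.
by exists i.+1.
Qed.

(* In [in_kernel], the notation [^] stands for [Nat.pow]. *)
Lemma Nat_powE (a n : nat) : Nat.pow a n = a ^ n.
Proof. by elim: n => //= n ->; rewrite expnS. Qed.

Lemma asym_automatic_block_types (Omega : finType) (k : nat)
    (f : nat -> Omega) :
  asym_automatic k f ->
  exists (T : finType) (tau : nat -> T), block_types k 1 f tau.
Proof.
move=> [reps Hreps]; pose T := ((size reps).-tuple Omega : finType).
pose tau n : T := map_tuple (fun h => h n) (in_tuple reps).
exists T, tau => a; rewrite mul1n.
(* Each offset gives a kernel sequence, hence one coordinate of the tuple [tau n]; the induction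
   picks these coordinates one offset at a time. *)
suff H R : R <= k ^ a -> exists W : T -> nat -> Omega,
    almost (fun n => forall r, r < R -> f (k ^ a * n + r) = W (tau n) r).
  exact: H.
elim: R => [_|R IH ltR]; first by exists (fun _ _ => f 0); apply: almost_all.
have [W HW] := IH (ltnW ltR).
have [|h /(In_nth_lt f) [i ilt ->] Hi] := Hreps (fun n => f (k ^ a * n + R)).
  by exists a, R; rewrite Nat_powE.
exists (fun (t : (size reps).-tuple Omega) r =>
  if r == R then nth (f 0) t i else W t r).
have Hi' : almost (fun n => f (k ^ a * n + R) = nth f reps i n).
  by exists (fun n => f (k ^ a * n + R) != nth f reps i n) => // n /negPn/eqP.
apply: almost_mono (almost_and HW Hi') => n [H1 H2] r.
rewrite ltnS leq_eqVlt; case: eqP => [-> _ | _ /= /H1 //].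
by rewrite H2 /tau /= (nth_map f).
Qed.

Lemma block_types_window (Omega : finType) (k c : nat) (f : nat -> Omega)
    (T : finType) (tau : nat -> T) :
  0 < k -> block_types k 1 f tau ->
  block_types k c.+1 f (fun n => [ffun j : 'I_c.+1 => tau (n + j)]).
Proof.
move=> k0 H a; have [W HW] := H a.
have A0 : 0 < k ^ a by rewrite expn_gt0 k0.
exists (fun (t : {ffun 'I_c.+1 -> T}) r =>
  W (t (inord (r %/ k ^ a))) (r %% k ^ a)).
have := almost_forall_lt (b := c.+1) (fun j _ => almost_shift j HW).
apply: almost_mono => n Hn r rlt.
have dlt : r %/ k ^ a < c.+1 by rewrite ltn_divLR.
rewrite ffunE inordK // -Hn // ?mul1n ?ltn_mod //.
by rewrite mulnDr -addnA (mulnC _ (r %/ _)) -divn_eq.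
Qed.

(** One [m] serves all types of positive upper density, so it can be fixed before the block
    lengths. *)
Lemma frequent_types (T : finType) (tau : nat -> T) :
  exists m, forall t, density_zero (fun n => tau n == t) \/
    forall N0, exists2 N, N0 <= N & N < m * count_below (fun n => tau n == t) N.
Proof.
suff H (s : seq T) : exists m, forall t, t \in s ->
    density_zero (fun n => tau n == t) \/
    forall N0, exists2 N, N0 <= N & N < m * count_below (fun n => tau n == t) N.
  by have [m Hm] := H (enum T); exists m => t; apply: Hm; rewrite mem_enum.
elim: s => [|a s [m Hm]]; first by exists 0.
have [za|nza] := classic (density_zero (fun n => tau n == a)).
  by exists m => t; rewrite inE => /predU1P[->|/Hm //]; left.
have [ma Hma] : exists ma, forall N0, exists2 N, N0 <= N &
    N < ma * count_below (fun n => tau n == a) N.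
  apply: NNPP => nex; apply: nza => ma _; apply: NNPP => nN0; apply: nex.
  exists ma => N0; apply: NNPP => nN; apply: nN0; exists N0 => N leN.
  by rewrite leqNgt; apply/negP => ltN; apply: nN; exists N.
exists (m + ma) => t; rewrite inE => /predU1P[->|/Hm [?|{}Hm]];
  [right|by left|right].
  by move=> N0; have [N ? ?] := Hma N0; exists N => //; nia.
by move=> N0; have [N ? ?] := Hm N0; exists N => //; nia.
Qed.

(** * Nearly equal powers of [k] and [l] *)

Lemma INR_expn (a n : nat) : INR (a ^ n) = (INR a ^ n)%Rstd.
Proof. by elim: n => [|n IH] //=; rewrite expnS mult_INR IH. Qed.

Lemma mult_independent_expn_neq (k l a b : nat) :
  2 <= k -> 2 <= l -> mult_independent k l -> 0 < b -> k ^ a != l ^ b.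
Proof.
move=> k2 l2 ind b0; apply/eqP => e; apply: ind.
have a0 : 0 < a.
  case: a e => // e; have : l ^ 1 <= l ^ b by rewrite leq_exp2l.
  by rewrite -e expn1 expn0; lia.
have INR_ge2 n : 2 <= n -> (1 < INR n)%Rstd.
  by move=> n2; apply: (lt_INR 1); lia.
have lnl : (0 < ln (INR l))%Rstd.
  by rewrite -ln_1; apply: ln_increasing; [lra | exact: INR_ge2].
have kpos := INR_ge2 k k2; have lpos := INR_ge2 l l2.
exists (BinInt.Z.of_nat b), (BinInt.Z.of_nat a); split; first by lia.
rewrite -!INR_IZR_INZ.
have aR : (0 < INR a)%Rstd by apply: lt_0_INR; lia.
have : ln (INR (k ^ a)) = ln (INR (l ^ b)) by rewrite e.
rewrite !INR_expn !ln_pow; [|lra|lra] => eR.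
apply: (Rmult_eq_reg_r (ln (INR l) * INR a)); last by nra.
transitivity (INR a * ln (INR k))%Rstd; first by field; lra.
by rewrite eR; field; lra.
Qed.

(* Pigeonhole on the fractions l ^ i / k ^ e i in [1, k), rounded down to
   multiples of 1 / (M + 1). *)
Lemma close_powers (k l M : nat) :
  2 <= k -> 2 <= l -> mult_independent k l -> exists a b,
    l ^ b < k ^ a /\ M * (k ^ a - l ^ b) <= l ^ b \/
    k ^ a < l ^ b /\ M * (l ^ b - k ^ a) <= k ^ a.
Proof.
move=> k2 l2 ind; pose M1 := M.+1; pose e i := trunc_log k (l ^ i).
pose bucket i := M1 * l ^ i %/ k ^ e i.
have k0 a : 0 < k ^ a by rewrite expn_gt0 (ltnW k2).
have l0 b : 0 < l ^ b by rewrite expn_gt0 (ltnW l2).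
have bucket_lt i : bucket i < k * M1.
  rewrite ltn_divLR // mulnAC -expnS mulnC ltn_pmul2r //.
  exact: trunc_log_ltn.
have bucket_ge i : M1 <= bucket i.
  by rewrite leq_divRL // leq_pmul2l // trunc_logP.
pose s := [seq bucket i | i <- iota 0 (k * M1).+1].
have /(uniqPn 0) [i [j [ltij]]] : ~~ uniq s.
  apply/negP => /(uniq_leq_size (s2 := iota 0 (k * M1))).
  rewrite size_map !size_iota ltnn => sub.
  suff /sub : {subset s <= iota 0 (k * M1)} by [].
  by move=> _ /mapP[i _ ->]; rewrite mem_iota bucket_lt.
rewrite size_map size_iota => ltj.
rewrite !(nth_map 0) ?size_iota ?(ltn_trans ltij) // !nth_iota ?(ltn_trans ltij) //.
rewrite !add0n => eq_b.
have lee : e i <= e j by apply: leq_trunc_log; rewrite leq_exp2l // ltnW.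
exists (e j - e i), (j - i).
have := mult_independent_expn_neq (e j - e i) k2 l2 ind (b := j - i).
rewrite subn_gt0 => /(_ ltij).
have lE : l ^ j = l ^ i * l ^ (j - i) by rewrite -expnD subnKC // ltnW.
have kE : k ^ e j = k ^ e i * k ^ (e j - e i) by rewrite -expnD subnKC.
have hi1 : bucket i * k ^ e i <= M1 * l ^ i by exact: leq_divM.
have hi2 : M1 * l ^ i < (bucket i).+1 * k ^ e i by rewrite -ltn_divLR.
have hj1 : bucket i * k ^ e j <= M1 * l ^ j by rewrite eq_b; exact: leq_divM.
have hj2 : M1 * l ^ j < (bucket i).+1 * k ^ e j by rewrite eq_b -ltn_divLR.
clear s ltj bucket_lt.
move: (bucket_ge i) (k0 (e i)) (l0 (j - i)) hi1 hi2 hj1 hj2; rewrite lE kE.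
move: (bucket i) (k ^ e i) (l ^ i) (k ^ (_ - _)) (l ^ (_ - _)) => c K L X Y.
move=> leMc K0 Y0 h1 h2 h3 h4 neXY.
(* Both fractions lie in [c, c + 1) / [M1], so X and Y differ by a factor below (c + 1) / c, where c
   > [M]. *)
have cX : c * X < c.+1 * Y.
  have : M1 * L * Y < c.+1 * K * Y by rewrite ltn_pmul2r.
  by rewrite -(ltn_pmul2l K0); nia.
have cY : c * Y < c.+1 * X.
  have : c * K * Y <= M1 * L * Y by rewrite leq_pmul2r.
  by rewrite -(ltn_pmul2l K0); nia.
move: neXY; case: (ltngtP X Y) => // lt _; [right|left]; split=> //; nia.
Qed.

(** The sign of the difference is fixed because the [k]-blocks will have to be the longer ones. *)
Definition close_above (k l : nat) : Prop :=
  forall M, exists a b, l ^ b < k ^ a /\ M * (k ^ a - l ^ b) <= l ^ b.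

(** If one side fails at [M0], then [close_powers] at [M + M0] can only return the other side, for
    every [M]. *)
Lemma close_above_or (k l : nat) :
  2 <= k -> 2 <= l -> mult_independent k l -> close_above k l \/ close_above l k.
Proof.
move=> k2 l2 ind; have [?|H] := classic (close_above k l); [by left|right].
have [M0 HM0] := not_all_ex_not _ _ H => M.
have [a [b [[lt1 le1]|[lt1 le1]]]] := close_powers (M + M0) k2 l2 ind.
  by case: HM0; exists a, b; split=> //; nia.
by exists b, a; split=> //; nia.
Qed.

(** * Short periods of windows *)

(* The window consists of the two blocks A x and A (x + 1). *)
Definition window_period (Omega : Type) (f : nat -> Omega) (A x p : nat) : Prop :=
  [/\ 0 < p, 2 * p <= A &
      forall u, A * x <= u -> u + p < A * x.+2 -> f (u + p) = f u].

(* The grid of step A and the grid of step B, aligned at the start [A H z] of a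
   group of H blocks, drift apart by at most B / 4 within the group; hence four
   consecutive B-blocks cover a window of two A-blocks. *)
Lemma period_of_two_shifts (Omega : Type) (f : nat -> Omega) (A B H z i d : nat) :
  0 < B -> B < A -> 4 * H * (A - B) <= B -> 0 < d -> i + d < H ->
  let x := H * z + i in let y := A * H * z %/ B + i in
  (forall r, r < 2 * A -> f (A * x + r) = f (A * (x + d) + r)) ->
  (forall r, r < 4 * B -> f (B * y + r) = f (B * (y + d) + r)) ->
  window_period f A x (d * (A - B)).
Proof.
move=> B0 ltBA leHB d0 ltH x y fA fB.
have [C AE] : exists C, A = B + C by exists (A - B); lia.
have CE : A - B = C by lia.
have dC : 4 * (d * C) <= B by nia.
have iC : 4 * (i * C) <= B by nia.
have C0 : 0 < C by lia.
have C4 : 4 * C <= B by nia.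
rewrite CE; split; [by nia | by nia |] => u leu ltu.
(* Offset of the window within the B-block [y]: a remainder below B plus a drift of C for each of
   the [i] blocks, at most B / 4. *)
pose e := A * H * z %% B + i * C.
have eE : A * x = B * y + e.
  rewrite /x /y /e !mulnDr mulnA {1}(divn_eq (A * H * z) B) AE; nia.
have elt : 4 * e < 5 * B.
  have : A * H * z %% B < B by rewrite ltn_mod.
  by rewrite /e; lia.
pose r := u - A * x.
have uE : u = A * x + r by rewrite /r; lia.
have rlt : r + d * C < 2 * A by move: ltu; rewrite uE !mulnS; lia.
have -> : u + d * C = B * y + (e + (r + d * C)) by lia.
(* Moving forward by d B and back by d A is a net shift by -d C. *)
rewrite fB; last by lia.
have -> : B * (y + d) + (e + (r + d * C)) = A * (x + d) + r.
  have : A * d = B * d + C * d by rewrite AE mulnDl.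
  by rewrite (mulnDr A x) (mulnDr B y) eE; lia.
by rewrite -fA ?uE //; lia.
Qed.

Lemma window_period_transfer (Omega : Type) (f : nat -> Omega) (A x x' p : nat) :
  (forall r, r < 2 * A -> f (A * x + r) = f (A * x' + r)) ->
  window_period f A x p -> window_period f A x' p.
Proof.
move=> fE [p0 pA Hp]; split=> // u leu ltu.
have -> : u = A * x' + (u - A * x') by lia.
by rewrite -addnA -!fE ?addnA ?Hp //; lia.
Qed.

(** If a frequent type had no common period, its occurrences outside [Bd] in a group of [H] blocks
    would have distinct [sigma (y x)]: at most #|S| per group, too few for its density. *)
Lemma window_periods (Omega : finType) (k l : nat) (f : nat -> Omega)
    (T S : finType) (tau : nat -> T) (sigma : nat -> S) :
  2 <= k -> 2 <= l -> close_above k l ->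
  block_types k 2 f tau -> block_types l 4 f sigma ->
  exists2 A, 0 < A & almost (fun x => exists p, window_period f A x p).
Proof.
move=> k2 l2 close Htau Hsigma.
have [m Hm] := frequent_types tau.
(* For suitable large N this leaves at most N / (2 (m + 1)) occurrences outside [Bd] and N / (4 (m +
   1)) inside, against more than N / m for a frequent type. *)
pose H := 4 * m.+1 * #|S|.+1.
have H0 : 0 < H by rewrite !muln_gt0.
(* As [H] is already fixed, the drift H (A - B) over a group can be made at most B / 4. *)
have [a [b [ltBA leBA]]] := close (4 * H).
have [W HW] := Htau a; have [V HV] := Hsigma b.
have B0 : 0 < l ^ b by rewrite expn_gt0 (ltnW l2).
move: (k ^ a) (l ^ b) ltBA leBA B0 HW HV => A B ltBA leBA B0 HW HV.
exists A; first by lia.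
(* [y] pairs the A-block x with a B-block; it is injective because B < A. *)
pose y x := A * H * (x %/ H) %/ B + x %% H.
(* A group of [H] A-blocks has room for [H] B-blocks, so distinct groups get disjoint values of
   [y]. *)
have y_step z : A * H * z %/ B + H <= A * H * z.+1 %/ B.
  rewrite addnC -divnMDl // leq_div2r // mulnS leq_add2r mulnC.
  by rewrite leq_mul2r (ltnW ltBA) orbT.
have y_incr x x' : x < x' -> y x < y x'.
  move=> ltx; have /orP[/eqP e|lt] : (x %/ H == x' %/ H) || (x %/ H < x' %/ H).
    by rewrite -leq_eqVlt leq_div2r // ltnW.
    rewrite /y -e ltn_add2l; move: ltx.
    by rewrite {1}(divn_eq x H) {1}(divn_eq x' H) e ltn_add2l.
  have le1 : A * H * (x %/ H).+1 %/ B <= A * H * (x' %/ H) %/ B.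
    by rewrite leq_div2r // leq_mul2l lt orbT.
  have := y_step (x %/ H); have : x %% H < H by rewrite ltn_mod.
  by rewrite /y; lia.
have y_inj x x' : y x = y x' -> x = x'.
  by case: (ltngtP x x') => // /y_incr; lia.
have y_le x : y x < 2 * x.+1.
  have le1 : A * H * (x %/ H) %/ B <= 2 * (x %/ H * H).
    rewrite -(@mulnK (2 * _) B) // leq_div2r // -mulnA (mulnC H) mulnAC.
    by rewrite leq_mul2r; apply/orP; right; nia.
  by rewrite /y; move: (divn_eq x H) le1; lia.
have HVy := almost_comp (w := fun=> 0) (b := 1)
  (fun x x' e _ => y_inj x x' e) y_le (fun=> isT) HV.
have [Bd zBd HBd] := almost_and HW HVy.
have good t : density_zero (fun n => tau n == t) \/ exists p, forall x,
    (forall r, r < 2 * A -> f (A * x + r) = W (tau x) r) -> tau x = t ->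
    window_period f A x p.
  have [?|freq] := Hm t; [by left|right].
  apply: NNPP => nogood.
  (* Such a pair yields a period that transfers to all decoded occurrences of [t], against
     [nogood]. *)
  have no_pair x x' : ~~ Bd x -> ~~ Bd x' -> tau x = t -> tau x' = t ->
      x %/ H = x' %/ H -> sigma (y x) = sigma (y x') -> x < x' -> False.
    move=> /HBd[Wx Vx] /HBd[Wx' Vx'] tx tx' ex es ltx.
    pose d := x' - x.
    have x'E : x' = x + d by rewrite /d; lia.
    have xE : x = H * (x %/ H) + x %% H by rewrite mulnC -divn_eq.
    have mE : x' %% H = x %% H + d.
      by move: (divn_eq x H) (divn_eq x' H); rewrite -ex; lia.
    have per : window_period f A x (d * (A - B)).
      rewrite {1}xE; apply: period_of_two_shifts ltBA leBA _ _ _ _ => //.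
      - by rewrite /d subn_gt0.
      - by rewrite -mE ltn_mod.
      - by move=> r rA; rewrite -xE -x'E Wx // Wx' // tx tx'.
      - move=> r rB.
        have -> : A * H * (x %/ H) %/ B + x %% H + d = y x'.
          by rewrite /y -ex mE addnA.
        by rewrite -/(y x) Vx // Vx' // es.
    apply: nogood; exists (d * (A - B)) => x0 Wx0 tx0.
    by apply: window_period_transfer per => r rA; rewrite Wx // Wx0 // tx tx0.
  have cnt N : count_below (fun n => (tau n == t) && ~~ Bd n) N
      <= (N %/ H).+1 * #|S|.
    rewrite -(size_iota 0 (N %/ H).+1) cardE -(size_allpairs pair).
    apply: (@count_below_le_size _ _ _ (fun x => (x %/ H, sigma (y x)))).
      move=> x x' _ _ /andP[/eqP tx bx] /andP[/eqP tx' bx'] [ex es].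
      case: (ltngtP x x') => // lt; first by case: (no_pair x x').
      by case: (no_pair x' x).
    move=> x xN _; apply/allpairsP; exists (x %/ H, sigma (y x)).
    split=> //; last by rewrite mem_enum.
    by rewrite mem_iota /= add0n ltnS leq_div2r // ltnW.
  have [|N1 HN1] := zBd (4 * m.+1); first by [].
  have [N leN] := freq (maxn N1 H).
  move: leN; rewrite geq_max => /andP[/HN1 leBd leH].
  have le1 : count_below (fun n => tau n == t) N <=
      count_below (fun n => (tau n == t) && ~~ Bd n) N + count_below Bd N.
    apply: leq_trans (count_below_or _ _ _); apply: count_below_sub => n ->.
    by rewrite /= orbC orbN.
  have := cnt N; have := leq_divM N H.
  move: (N %/ H) (count_below _ N) (count_below _ N) (count_below _ N) le1 leBd.
  move=> h c1 c2 c3; rewrite /H in leH *; nia.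
have types : almost (fun x => forall t, t \in enum T -> tau x = t ->
    exists p, forall x',
      (forall r, r < 2 * A -> f (A * x' + r) = W (tau x') r) -> tau x' = t ->
      window_period f A x' p).
  apply: almost_forall_seq => t _; have [zt|gt] := good t.
    by exists (fun n => tau n == t) => // n /eqP.
  by apply: almost_all.
apply: almost_mono (almost_and HW types) => x [Wx Hx].
have [|p Hp] := Hx (tau x) _ erefl; first by rewrite mem_enum.
by exists p; apply: Hp.
Qed.

(** * From local periods to a global shift *)

(** The window whose second block contains u + p has a period p'. Step back by p', apply induction,
    step forward: since p + p' <= A, all four points lie in that window. *)
Lemma periodic_chain (Omega : Type) (f : nat -> Omega) (A x p L : nat) :
  window_period f A x p ->
  (forall j, j < L -> exists p', window_period f A (x + j) p') ->
  forall u, A * x <= u -> u + p < A * (x + L).+1 -> f (u + p) = f u.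
Proof.
move=> [p0 pA Hp] HL u; have [n] := ubnP u; elim: n u => // n IH u ltun leu ltu.
have A0 : 0 < A by lia.
have [lt2|ge2] := ltnP (u + p) (A * x.+2); first exact: Hp.
pose w := (u + p) %/ A.
have wl : w * A <= u + p by exact: leq_divM.
have wr : u + p < w.+1 * A by rewrite -ltn_divLR.
have wx : x.+2 <= w by rewrite leq_divRL // mulnC.
have wL : w < (x + L).+1 by rewrite ltn_divLR // mulnC.
have [|p' [p'0 p'A Hp']] := HL (w - x.+1); first by lia.
move: Hp'; have -> : x + (w - x.+1) = w.-1 by lia.
have AwE : A * w = A * w.-1 + A by rewrite -{1}(@prednK w) ?mulnS 1?addnC //; lia.
have -> : A * w.-1.+2 = A * w + A by rewrite prednK ?mulnS 1?addnC //; lia.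
have xw : A * x <= A * w.-1 by rewrite leq_mul2l; apply/orP; right; lia.
rewrite mulnC in wl; rewrite mulSn (mulnC w) in wr.
move=> Hp'; pose v := u - p'.
have uE : u = v + p' by rewrite /v; lia.
have e1 : f (v + p') = f v by apply: Hp'; lia.
have e2 : f (v + p + p') = f (v + p) by apply: Hp'; lia.
have e3 : f (v + p) = f v by apply: IH; lia.
by rewrite uE addnAC e1 e2.
Qed.

Lemma asym_shift_of_window_periods (Omega : finType) (f : nat -> Omega) (A : nat) :
  0 < A -> almost (fun x => exists p, window_period f A x p) ->
  exists q, 0 < q /\ asym_eq (fun n => f (n + q)) f.
Proof.
(* Every window period is at most A / 2, hence divides [A!]. *)
move=> A0 HA; exists A`!; split; first exact: fact_gt0.
pose P := A`!.
(* The [P.+1] windows from the block of n onwards reach beyond n + P. *)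
have [Bd zBd HBd] := almost_divn A0 (almost_forall_lt (b := P.+1)
  (fun j _ => almost_shift j (P := fun x => exists p, window_period f A x p) HA)).
apply: density_zero_sub zBd => n; apply: contraNT => /HBd Hn; apply/eqP.
have [p Hp] := Hn 0 isT; rewrite addn0 in Hp.
have chain := periodic_chain Hp Hn.
have nlt : n < (n %/ A).+1 * A by rewrite -ltn_divLR.
have len : n %/ A * A <= n by exact: leq_divM.
have iterp j : j * p <= P -> f (n + j * p) = f n.
  elim: j => [|j IH] le; first by rewrite addn0.
  rewrite mulSn (addnC p) addnA chain.
  - by apply: IH; rewrite (leq_trans _ le) // leq_mul2r leqnSn orbT.
  - by rewrite mulnC; lia.
  - by rewrite mulSn in le; nia.
have /dvdnP[c cE] : p %| P.
  by case: Hp => p0 p2 _; apply: dvdn_fact; rewrite p0 /=; lia.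
by have := iterp c; rewrite -cE; apply.
Qed.

Lemma asym_shift_of_close_above (Omega : finType) (k l : nat) (f : nat -> Omega) :
  2 <= k -> 2 <= l -> close_above k l ->
  asym_automatic k f -> asym_automatic l f ->
  exists q : nat, 0 < q /\ asym_eq (fun n => f (n + q)) f.
Proof.
move=> k2 l2 close /asym_automatic_block_types [T [tau Htau]].
move=> /asym_automatic_block_types [S [sigma Hsigma]].
(* The arguments 1 and 3 give two [k]-blocks and four [l]-blocks, the numbers required by
   [window_periods]. *)
have [A A0 HA] := window_periods k2 l2 close
  (block_types_window 1 (ltnW k2) Htau)
  (block_types_window 3 (ltnW l2) Hsigma).
exact: asym_shift_of_window_periods A0 HA.
Qed.

Theorem theoremA (Omega : finType) (k l : nat) (f : nat -> Omega) :
  2 <= k -> 2 <= l -> mult_independent k l ->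
  asym_automatic k f -> asym_automatic l f ->
  exists q : nat, 0 < q /\ asym_eq (fun n => f (n + q)) f.
Proof.
move=> k2 l2 ind fk fl; have [close|close] := close_above_or k2 l2 ind.
  exact: asym_shift_of_close_above close fk fl.
exact: asym_shift_of_close_above close fl fk.
Qed.
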